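(* Let $K$ be a field of characteristic zero and let $\sigma\in S_n$ be an involution ($\sigma^2=\mathrm{id}$). Then the linear subspace $\mathfrak{p}_\sigma=\mathrm{span}_K\{y_{it} : \varepsilon_t-\varepsilon_i\in\Pi_\sigma\}$ of $\mathfrak{n}$ is a polarization for every $f\in X_\sigma$.
   Context: $N=\mathrm{UT}(n,K)$ is the group of lower triangular $n\times n$ matrices over $K$ with ones on the diagonal, and $\mathfrak{n}=\mathfrak{ut}(n,K)$ is its Lie algebra of strictly lower triangular matrices, with standard basis $y_{ij}$ ($1\le j<i\le n$, the matrix unit with $1$ in row $i$, column $j$). $\mathfrak{n}^*$ is the dual space. A subalgebra $\mathfrak{p}\subset\mathfrak{n}$ is a polarization of $f\in\mathfrak{n}^*$ if $\mathfrak{p}$ is a maximal isotropic subspace with respect to the skew-symmetric form $(x,y)\mapsto f([x,y])$ on $\mathfrak{n}$. $\Delta^+=\{\varepsilon_j-\varepsilon_i : 1\le j<i\le n\}$ is the set of positive roots of $\mathfrak{gl}(n,K)$; for $\xi=\varepsilon_j-\varepsilon_i\in\Delta^+$ put $j(\xi)=j$, $i(\xi)=i$, $y_\xi=y_{ij}$, and let $r_\xi\in S_n$ be the transposition $(j,i)$. $S_n$ acts on roots by $w(\varepsilon_j-\varepsilon_i)=\varepsilon_{w(j)}-\varepsilon_{w(i)}$, and $\gamma>0$ (resp. $\gamma<0$) means that the root $\gamma$ is positive (resp. negative). The involution decomposes uniquely as a product of commuting reflections $\sigma=r_1\cdots r_s$, $r_m=r_{\xi_m}$, $\xi_m\in\Delta^+$,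 numbered so that $j(\xi_1)<\dots<j(\xi_s)$. Put $\mathcal{S}=\{\xi_1,\dots,\xi_s\}$. $X_\sigma\subset\mathfrak{n}^*$ is the set of all $f$ with $f(y_{\xi_m})\neq0$ for $1\le m\le s$ and $f(y_\gamma)=0$ for all $\gamma\in\Delta^+\setminus\mathcal{S}$. For $1\le t\le n-1$ let $\sigma_t=\prod_{j(\xi_m)\le t}r_m$, and $\sigma_0=\mathrm{id}$. $\Pi_\sigma$ is the set of all $\eta\in\Delta^+$ such that $\sigma_{t-1}(\eta)>0$, where $t=j(\eta)$. *)

(* Defs.v *)
From mathcomp Require Import all_boot all_order all_fingroup all_algebra.

Set Implicit Arguments.
Unset Strict Implicit.
Unset Printing Implicit Defensive.

Import GRing.Theory.
Local Open Scope ring_scope.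

(* The root eps_j - eps_i is the pair (j, i); a pair with equal components is
   not a root, and none arises below.  Indices start at 0: the index j in 1..n
   is the ordinal of value j - 1. *)
Definition act_root n (w : 'S_n) (a : 'I_n * 'I_n) : 'I_n * 'I_n :=
  (w a.1, w a.2).

Definition positive n (a : 'I_n * 'I_n) : bool := (a.1 < a.2)%N.

Definition posroot n := {a : 'I_n * 'I_n | positive a}.

Definition jr n (xi : posroot n) : 'I_n := (val xi).1.
Definition ir n (xi : posroot n) : 'I_n := (val xi).2.

Definition refl n (xi : posroot n) : 'S_n := tperm (jr xi) (ir xi).

Definition unit_mx (K : fieldType) n (xi : posroot n) : 'M[K]_n :=
  delta_mx (ir xi) (jr xi).

Definition utv (K : fieldType) n : {vspace 'M[K]_n} :=
  <<[seq unit_mx K xi | xi : posroot n]>>%VS.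

Notation ut K n := (subvs_of (utv K%type n%N)).
Notation dual_ut K n := 'Hom(ut K%type n%N, K^o).

Section LieAlgebra.

Variables (K : fieldType) (n : nat).
Implicit Types (A B : 'M[K]_n) (xi : posroot n).

Lemma mem_unit_mx xi : unit_mx K xi \in utv K n.
Proof. by apply/memv_span/image_f. Qed.

Lemma mem_utvP A :
  reflect (forall i j : 'I_n, (i <= j)%N -> A i j = 0) (A \in utv K n).
Proof.
apply: (iffP idP) => [|A0].
  move/coord_span=> -> i j le_ij; rewrite summxE big1 // => k _.
  set M := (_`_k); have /imageP[xi _ ->] : M \in image (@unit_mx K n) predT.
    by rewrite /M mem_nth // size_tuple.
  rewrite !mxE; case: eqP => [ei|]; case: eqP => [ej|] //=; rewrite ?mulr0 //.
  have := valP xi; rewrite /positive -/(jr xi) -/(ir xi) -ei -ej.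
  by rewrite ltnNge le_ij.
rewrite (matrix_sum_delta A); apply: memv_suml => i _; apply: memv_suml => j _.
have [lt_ji|le_ij] := ltnP j i; last by rewrite A0 // scale0r mem0v.
by apply/memvZ/(mem_unit_mx (exist _ (j, i) lt_ji)).
Qed.

Lemma utv_mul A B : A \in utv K n -> B \in utv K n -> A *m B \in utv K n.
Proof.
move=> /mem_utvP A0 /mem_utvP B0; apply/mem_utvP => i j le_ij.
rewrite mxE big1 // => k _; have [le_ik|lt_ki] := leqP i k.
  by rewrite A0 ?mul0r.
by rewrite [B k j]B0 ?mulr0 // (leq_trans (ltnW lt_ki)).
Qed.

Lemma lie_subproof (x y : ut K n) :
  vsval x *m vsval y - vsval y *m vsval x \in utv K n.
Proof. by apply: rpredB; apply: utv_mul; apply: subvsP. Qed.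

Definition lie (x y : ut K n) : ut K n := Subvs (lie_subproof x y).

Definition y_ xi : ut K n := Subvs (mem_unit_mx xi).

Definition subalgebra (p : {vspace ut K n}) : Prop :=
  {in p &, forall x y, lie x y \in p}.

Definition isotropic (f : dual_ut K n) (p : {vspace ut K n}) : Prop :=
  {in p &, forall x y, f (lie x y) = 0}.

Definition max_isotropic (f : dual_ut K n) (p : {vspace ut K n}) : Prop :=
  isotropic f p /\
  forall q : {vspace ut K n}, isotropic f q -> (p <= q)%VS -> q = p.

Definition polarization (f : dual_ut K n) (p : {vspace ut K n}) : Prop :=
  subalgebra p /\ max_isotropic f p.

End LieAlgebra.

Section Involution.

Variable n : nat.
Implicit Types (sigma : 'S_n) (s : seq (posroot n)).

Definition refl_decomposition sigma s : Prop :=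
  [/\ sorted (fun xi eta => jr xi < jr eta)%N s,
      {in s &, forall xi eta, commute (refl xi) (refl eta)}
    & sigma = (\prod_(xi <- s) refl xi)%g].

(* With 1-based indices j(xi) = (jr xi).+1, so sigma_upto s 0 is the identity
   and sigma_{t-1} for t = j(eta) is sigma_upto s (jr eta). *)
Definition sigma_upto s (t : nat) : 'S_n :=
  (\prod_(xi <- s | ((jr xi).+1 <= t)%N) refl xi)%g.

Definition Pi_ s : {set posroot n} :=
  [set eta | positive (act_root (sigma_upto s (jr eta)) (val eta))].

Definition X_ (K : fieldType) s (f : dual_ut K n) : Prop :=
  (forall xi, xi \in s -> f (y_ K xi) != 0) /\
  (forall gamma, gamma \notin s -> f (y_ K gamma) = 0).

Definition p_ (K : fieldType) s : {vspace ut K n} :=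
  <<[seq y_ K eta | eta in Pi_ s]>>%VS.

(* Existence and uniqueness of the decomposition of an involution. *)

Let jr_lt_ir (xi : posroot n) : (jr xi < ir xi)%N := valP xi.

Let refl_in (xi : posroot n) x :
  x \in [:: jr xi; ir xi] -> refl xi x \in [:: jr xi; ir xi].
Proof.
by rewrite !inE /refl => /orP[] /eqP->; rewrite (tpermL, tpermR) eqxx ?orbT.
Qed.

Let refl_out (xi : posroot n) x :
  x \notin [:: jr xi; ir xi] -> refl xi x = x.
Proof.
by rewrite !inE negb_or /refl => /andP[xj xi'];
  rewrite tpermD // eq_sym.
Qed.

Let posroot_eq (xi eta : posroot n) :
  jr xi = jr eta -> ir xi = ir eta -> xi = eta.
Proof.
by move=> ej ei; apply: val_inj; rewrite [LHS]surjective_pairing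
  [RHS]surjective_pairing; congr pair.
Qed.

Let refl_neq (xi : posroot n) x :
  x \in [:: jr xi; ir xi] -> refl xi x != x.
Proof.
rewrite !inE /refl neq_ltn => /orP[] /eqP->; rewrite ?tpermL ?tpermR.
  by rewrite jr_lt_ir orbT.
by rewrite jr_lt_ir.
Qed.

(* Distinct commuting reflections have disjoint supports. *)
Let refl_commute (xi eta : posroot n) x :
    commute (refl xi) (refl eta) -> xi != eta ->
  x \in [:: jr xi; ir xi] -> refl eta x = x.
Proof.
move=> com neq x_xi; apply: contraNeq neq => Nx; apply/eqP.
have ex_xi : refl eta x \in [:: jr xi; ir xi].
  apply: contraNT (refl_neq x_xi) => /refl_out.
  by rewrite -permM -com permM => /perm_inj->.
have x_eta : x \in [:: jr eta; ir eta] by apply: contraNT Nx => /refl_out->.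
have lt1 := jr_lt_ir xi; have lt2 := jr_lt_ir eta.
have lt_asym (a b : 'I_n) : (a < b)%N -> (b < a)%N -> False.
  by move=> ab /(ltn_trans ab); rewrite ltnn.
move: x_xi ex_xi x_eta Nx; rewrite !inE /refl.
case/orP=> /eqP->; case/orP=> /eqP e; rewrite e ?eqxx // => /orP[] /eqP e' _;
  move: e; rewrite e' ?tpermL ?tpermR => e.
- exact: posroot_eq.
- by case: (lt_asym _ _ lt1); rewrite e' -e.
- by case: (lt_asym _ _ lt1); rewrite e' -e.
- exact: posroot_eq.
Qed.

Let prod_out s x :
  (forall xi, xi \in s -> refl xi x = x) -> (\prod_(xi <- s) refl xi)%g x = x.
Proof.
elim: s => [|a s IH] fix_x; first by rewrite big_nil perm1.
rewrite big_cons permM fix_x ?mem_head // IH // => xi xi_s.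
by rewrite fix_x // inE xi_s orbT.
Qed.

Let prod_in s xi x :
    uniq s -> {in s &, forall xi eta, commute (refl xi) (refl eta)} ->
  xi \in s -> x \in [:: jr xi; ir xi] ->
  (\prod_(xi <- s) refl xi)%g x = refl xi x.
Proof.
elim: s => // a s IH /= /andP[aNs Us] com; rewrite inE big_cons permM.
have com' : {in s &, forall xi eta, commute (refl xi) (refl eta)}.
  by move=> b c bs cs; apply: com; rewrite inE (bs, cs) orbT.
have [->|neq] /= := eqVneq xi a => [_|xi_s] x_xi.
  apply: prod_out => b bs; apply: refl_commute (refl_in x_xi).
    by apply: com; rewrite inE ?eqxx ?bs ?orbT.
  by apply: contraNneq aNs => ->.
rewrite (refl_commute _ neq x_xi) ?IH //.
by apply: com; rewrite inE ?eqxx ?xi_s ?orbT.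
Qed.

Let sorted_jr s :
  sorted (fun xi eta => jr xi < jr eta)%N s = sorted ltn [seq val (jr xi) | xi <- s].
Proof. by rewrite sorted_map. Qed.

Let decomp_uniq sigma s : refl_decomposition sigma s -> uniq s.
Proof.
case; rewrite sorted_jr => srt _ _.
by apply: (@map_uniq _ _ (fun xi => val (jr xi))); apply: sorted_uniq srt;
  [exact: ltn_trans | exact: ltnn].
Qed.

Lemma mem_refl_decomposition sigma s : refl_decomposition sigma s ->
  forall xi, (xi \in s) = (sigma (jr xi) == ir xi).
Proof.
move=> dec xi; have Us := decomp_uniq dec; case: dec => _ com ->.
apply/idP/eqP => [xi_s|exi].
  by rewrite (prod_in Us com xi_s) ?mem_head // /refl tpermL.
have /hasP[eta eta_s j_eta] : has (fun eta => jr xi \in [:: jr eta; ir eta]) s.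
  apply/negP => /negP/hasPn out; move: (jr_lt_ir xi).
  by rewrite -exi prod_out ?ltnn // => eta /out /refl_out.
move: exi; rewrite (prod_in Us com eta_s j_eta).
move: j_eta; rewrite !inE => /orP[] /eqP ej; rewrite ej /refl ?tpermL ?tpermR => ei.
  by rewrite (posroot_eq ej (esym ei)).
by have := jr_lt_ir xi; rewrite ej -ei ltnNge ltnW ?jr_lt_ir.
Qed.

Lemma refl_decomposition_uniq sigma s s' :
  refl_decomposition sigma s -> refl_decomposition sigma s' -> s = s'.
Proof.
move=> dec dec'; have mem := mem_refl_decomposition dec.
have mem' := mem_refl_decomposition dec'; case: dec dec' => [srt _ _] [srt' _ _].
apply: irr_sorted_eq srt srt' _; first by move=> y x z; apply: ltn_trans.
  by move=> x; apply: ltnn.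
by move=> xi; rewrite mem mem'.
Qed.

Lemma refl_decomposition_exists sigma :
  (sigma * sigma = 1)%g -> exists s, refl_decomposition sigma s.
Proof.
move=> /permP inv; have sK x : sigma (sigma x) = x by rewrite -permM inv perm1.
pose A := [set xi : posroot n | sigma (jr xi) == ir xi].
pose le (xi eta : posroot n) := (jr xi <= jr eta)%N.
pose s := sort le (enum A).
have mem xi : (xi \in s) = (sigma (jr xi) == ir xi).
  by rewrite mem_sort mem_enum inE.
have Us : uniq s by rewrite sort_uniq enum_uniq.
have com : {in s &, forall xi eta, commute (refl xi) (refl eta)}.
  move=> xi eta; rewrite !mem => /eqP exi /eqP eeta.
  have [->|neq] := eqVneq xi eta; first by [].
  have sj : sigma (ir xi) = jr xi by rewrite -exi sK.
  have si : sigma (ir eta) = jr eta by rewrite -eeta sK.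
  have neqj : jr xi != jr eta.
    by apply: contraNneq neq => e; apply/eqP/posroot_eq; rewrite // -exi -eeta e.
  have neqi : ir xi != ir eta.
    by apply: contraNneq neqj => e; rewrite -sj -si e.
  have cross (a b : posroot n) : sigma (jr a) = ir a -> sigma (jr b) = ir b ->
      jr a != ir b.
    move=> ea eb; apply/eqP => e; have := jr_lt_ir a.
    by rewrite -ea e -eb sK eb ltnNge ltnW.
  have cross1 := cross _ _ exi eeta; have cross2 := cross _ _ eeta exi.
  apply/commgP/conjg_fixP; rewrite /refl tpermJ.
  by rewrite !tpermD // eq_sym.
exists s; split=> //.
  rewrite sorted_jr ltn_sorted_uniq_leq map_inj_in_uniq ?Us /=.
    by rewrite sorted_map; apply: sort_sorted => xi eta; apply: leq_total.
  move=> xi eta; rewrite !mem => /eqP exi /eqP eeta /val_inj e.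
  by apply: posroot_eq => //; rewrite -exi -eeta e.
apply/permP => x; case: (ltngtP x (sigma x)) => [lt|lt|/val_inj e].
- pose xi : posroot n := exist _ (x, sigma x) lt.
  by rewrite (@prod_in s xi) // ?mem ?mem_head // /refl tpermL.
- pose xi : posroot n := exist _ (sigma x, x) lt.
  by rewrite (@prod_in s xi) // ?mem ?inE ?eqxx ?orbT // ?sK // /refl tpermR.
rewrite prod_out // => xi; rewrite mem => /eqP exi.
apply: refl_out; rewrite !inE negb_or; apply/andP; split; apply/eqP => ex.
  by have := jr_lt_ir xi; rewrite -exi -ex -e ltnn.
by have := jr_lt_ir xi; rewrite -ex e ex -exi sK ltnn.
Qed.

End Involution.

(* Main.v *)
Require Import Defs.
From mathcomp Require Import all_boot all_order all_fingroup all_algebra.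

(** Why the theorem holds.  Everything reduces to an explicit description of
    the complement of Pi: unwinding the truncated involutions, the root
    eps_t - eps_i lies outside Pi exactly when sigma(i) < t and
    sigma(i) < sigma(t) (see [mem_Pi]).  Call this condition Q(t, i) ([off_Pi]).
    Since p is the coordinate subspace of the matrices whose (i, t) entries
    vanish whenever Q(t, i) holds, the three claims become statements on indices.

    - Subalgebra: for t < k < i, Q(t, i) forces Q(t, k) or Q(k, i), so every
      term of the (i, t) entry of a product of two elements of p vanishes.
    - Isotropy: f only sees the entries (sigma(t), t) with t < sigma(t), and for
      t < k < sigma(t) again Q(t, k) or Q(k, sigma(t)) holds.
    - Maximality: p contains its own orthogonal.  If Q(t, i) holds then
      eps_sigma(i) - eps_t is a root of Pi, and f([x, y_(t, sigma(i))]) has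
      x_(i, t) f(y_(i, sigma(i))) as its only nonzero term: the one other
      candidate is the entry of x at (sigma(i), sigma(t)), which is zero because
      sigma(i) < sigma(t).  So an x orthogonal to p has x_(i, t) = 0. *)

Set Implicit Arguments.
Unset Strict Implicit.
Unset Printing Implicit Defensive.

Import GRing.Theory.

(** * Truncated involutions and the set Pi *)

Section Roots.

Variable n : nat.
Implicit Types (sigma : 'S_n) (s : seq (posroot n)) (xi eta : posroot n).

Lemma jr_lt_ir xi : (jr xi < ir xi)%N.
Proof. exact: (valP xi). Qed.

Lemma refl_decomposition_invol sigma s x :
  refl_decomposition sigma s -> sigma (sigma x) = x.
Proof.
case=> _ com ->; rewrite -permM.
suff -> : (\prod_(xi <- s) refl xi * \prod_(xi <- s) refl xi = 1)%g.
  by rewrite perm1.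
elim: s com => [|a s IH] com; first by rewrite big_nil mulg1.
have com' : {in s &, forall xi eta, commute (refl xi) (refl eta)}.
  by move=> b c bs cs; apply: com; rewrite inE (bs, cs) orbT.
have com_a : commute (refl a) (\prod_(xi <- s) refl xi)%g.
  rewrite big_seq; apply: (big_ind (commute (refl a))) => [||xi xi_s].
  - exact: commute1.
  - exact: commuteM.
  by apply: com; rewrite inE ?eqxx ?xi_s ?orbT.
by rewrite big_cons mulgA -(mulgA (refl a)) -com_a mulgA tperm2 mul1g IH.
Qed.

(** Truncating the product amounts to filtering the sequence, so the results
    on decompositions apply to each truncated involution. *)
Lemma refl_decomposition_upto sigma s t : refl_decomposition sigma s ->
  refl_decomposition (sigma_upto s t) [seq xi <- s | (jr xi < t)%N].
Proof.
case=> srt com _; split; last by rewrite /sigma_upto big_filter.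
  by apply: sorted_filter srt => y x z; apply: ltn_trans.
move=> xi eta; rewrite !mem_filter => /andP[_ xi_s] /andP[_ eta_s].
exact: com.
Qed.

(** A point is moved by the truncation exactly when the smaller end of its
    2-cycle has been reached. *)
Lemma sigma_uptoE sigma s t x : refl_decomposition sigma s ->
  sigma_upto s t x = if (minn x (sigma x) < t)%N then sigma x else x.
Proof.
move=> dec; have dec_t := refl_decomposition_upto t dec.
set tau := sigma_upto s t in dec_t *.
have sK y := refl_decomposition_invol y dec.
have tK y := refl_decomposition_invol y dec_t.
have mem_lt (y z : 'I_n) : (y < z)%N ->
    (tau y == z) = (y < t)%N && (sigma y == z).
  move=> lt_yz; pose xi : posroot n := exist _ (y, z) lt_yz.
  rewrite -[LHS](mem_refl_decomposition dec_t xi) mem_filter.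
  by rewrite (mem_refl_decomposition dec xi).
have mem_t z : x != z -> (tau x == z) = (minn x z < t)%N && (sigma x == z).
  rewrite neq_ltn => /orP[] lt.
    by rewrite mem_lt // (minn_idPl (ltnW lt)).
  by rewrite (can2_eq tK tK) (can2_eq sK sK) eq_sym mem_lt // eq_sym
    (minn_idPr (ltnW lt)).
have [tx|tx] := eqVneq x (tau x); last first.
  by have := mem_t _ tx; rewrite eqxx => /esym/andP[lt /eqP->]; rewrite lt.
have [<-|sx] := eqVneq x (sigma x); first by rewrite if_same -tx.
by have := mem_t _ sx; rewrite -tx eqxx andbT (negPf sx) => <-.
Qed.

(** With t = jr eta < i = ir eta, the truncated involution sends t to
    min(t, sigma(t)), and sends i to sigma(i) if sigma(i) < t and to i
    otherwise.  In the second case the image root is clearly positive; in the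
    first it is negative iff sigma(i) < min(t, sigma(t)). *)
Lemma mem_Pi sigma s eta : refl_decomposition sigma s ->
  (eta \in Pi_ s) =
    ~~ ((sigma (ir eta) < jr eta) && (sigma (ir eta) < sigma (jr eta)))%N.
Proof.
move=> dec; have lt := jr_lt_ir eta.
have neq : sigma (jr eta) != sigma (ir eta) :> nat.
  by rewrite (inj_eq val_inj) (inj_eq perm_inj) neq_ltn lt.
rewrite inE /positive /act_root -/(jr eta) -/(ir eta) !(sigma_uptoE _ _ dec).
rewrite !gtn_min ltnn (ltnNge (ir eta)) (ltnW lt) /=.
case: (ltnP (sigma (jr eta)) (jr eta)) => h1;
  case: (ltnP (sigma (ir eta)) (jr eta)) => h2 /=.
- by rewrite ltn_neqAle neq leqNgt.
- by rewrite (ltn_trans h1 lt).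
- by rewrite (leq_trans h2 h1) ltnNge ltnW.
- by rewrite lt.
Qed.

End Roots.

(** * Coordinates on strictly lower triangular matrices *)

Section Polarization.

Variables (K : fieldType) (n : nat).
Implicit Types (x y z : ut K n) (xi eta : posroot n) (f : dual_ut K n).

Local Open Scope ring_scope.

Lemma ut_entry0 x (i j : 'I_n) : (i <= j)%N -> vsval x i j = 0.
Proof. exact/mem_utvP/subvsP. Qed.

Lemma scaled_y_entry (c : K) xi (i j : 'I_n) :
  vsval (c *: y_ K xi) i j = c * ((i == ir xi) && (j == jr xi))%:R.
Proof. by rewrite [vsval _]linearZ !mxE. Qed.

Lemma posroot_eq xi eta : jr xi = jr eta -> ir xi = ir eta -> xi = eta.
Proof.
by move=> ej ei; apply: val_inj; rewrite [LHS]surjective_pairing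
  [RHS]surjective_pairing; congr pair.
Qed.

Lemma ut_basisE x : x = \sum_xi vsval x (ir xi) (jr xi) *: y_ K xi.
Proof.
apply: val_inj => /=; rewrite linear_sum; apply/matrixP => i j.
rewrite summxE; have [le_ij|lt_ji] := leqP i j.
  rewrite ut_entry0 // big1 // => xi _; rewrite [LHS]scaled_y_entry.
  case: andP => [[/eqP ei /eqP ej]|]; rewrite ?mulr0 //.
  by have := jr_lt_ir xi; rewrite -ei -ej ltnNge le_ij.
rewrite (bigD1 (exist _ (j, i) lt_ji : posroot n)) //= big1 => [|xi neq].
  by rewrite addr0 [RHS]scaled_y_entry !eqxx mulr1.
rewrite [LHS]scaled_y_entry.
case: andP => [[/eqP ei /eqP ej]|]; rewrite ?mulr0 //.
by case/eqP: neq; apply: posroot_eq.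
Qed.

Lemma dualE f x : f x = \sum_xi vsval x (ir xi) (jr xi) * f (y_ K xi).
Proof.
rewrite {1}[x]ut_basisE linear_sum; apply: eq_bigr => xi _.
by rewrite linearZ.
Qed.

Lemma mem_p s x : reflect
  (forall eta, eta \notin Pi_ s -> vsval x (ir eta) (jr eta) = 0)
  (x \in p_ K s).
Proof.
apply: (iffP idP) => [|x0].
  move/coord_span=> -> eta etaN; rewrite linear_sum summxE big1 // => k _.
  set v := (_`_k).
  have /imageP[xi xiP ->] : v \in [seq y_ K eta | eta in Pi_ s].
    by rewrite /v mem_nth // size_tuple.
  rewrite [LHS]scaled_y_entry.
  case: andP => [[/eqP ei /eqP ej]|]; rewrite ?mulr0 //.
  by move: etaN; rewrite (posroot_eq ej ei) xiP.
rewrite [x]ut_basisE; apply: memv_suml => xi _.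
have [xiP|xiN] := boolP (xi \in Pi_ s); last by rewrite x0 // scale0r mem0v.
by apply/memvZ/memv_span/image_f.
Qed.

Lemma lie_y_entry x xi (i j : 'I_n) :
  vsval (lie x (y_ K xi)) i j =
    vsval x i (ir xi) * (j == jr xi)%:R - (i == ir xi)%:R * vsval x (jr xi) j.
Proof.
rewrite /= [LHS]mxE [X in _ + X]mxE; congr (_ - _); rewrite mxE.
  rewrite (bigD1 (ir xi)) //= big1 => [|k /negPf neq]; rewrite !mxE.
    by rewrite eqxx addr0.
  by rewrite neq mulr0.
rewrite (bigD1 (jr xi)) //= big1 => [|k /negPf neq]; rewrite !mxE.
  by rewrite eqxx andbT addr0.
by rewrite neq andbF mul0r.
Qed.

(** * The subspace p and its orthogonal *)

Section Involution.

Variables (sigma : 'S_n) (s : seq (posroot n)).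
Hypothesis dec : refl_decomposition sigma s.

Let sK a : sigma (sigma a) = a.
Proof. exact: refl_decomposition_invol dec. Qed.

Definition off_Pi (t i : 'I_n) : bool :=
  ((sigma i < t) && (sigma i < sigma t))%N.

Lemma p_entry0 x (i t : 'I_n) : x \in p_ K s -> off_Pi t i -> vsval x i t = 0.
Proof.
move=> /mem_p x0 off; have [le_it|lt_ti] := leqP i t; first exact: ut_entry0.
by apply: (x0 (exist _ (t, i) lt_ti)); rewrite (mem_Pi _ dec) negbK.
Qed.

(** Both the subalgebra property and isotropy come down to finding, for each
    intermediate index, a root outside Pi. *)
Lemma lie_entry0 x y (i t : 'I_n) : x \in p_ K s -> y \in p_ K s ->
    (forall k : 'I_n, (t < k)%N -> (k < i)%N -> off_Pi t k || off_Pi k i) ->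
  vsval (lie x y) i t = 0.
Proof.
move=> xp yp off.
have mul0 u v : u \in p_ K s -> v \in p_ K s ->
    (vsval u *m vsval v) i t = 0.
  move=> up vp; rewrite mxE big1 // => k _.
  have [le_ik|lt_ki] := leqP i k; first by rewrite ut_entry0 ?mul0r.
  have [le_kt|lt_tk] := leqP k t; first by rewrite (ut_entry0 v) ?mulr0.
  have /orP[o|o] := off k lt_tk lt_ki; first by rewrite (p_entry0 vp) ?mulr0.
  by rewrite (p_entry0 up) ?mul0r.
by rewrite /= [LHS]mxE [X in _ + X]mxE !mul0 // subr0.
Qed.

Lemma p_subalgebra : subalgebra (p_ K s).
Proof.
move=> x y xp yp; apply/mem_p => eta; rewrite (mem_Pi _ dec) negbK.
case/andP=> lt_t lt_st; apply: lie_entry0 => // k lt_tk _.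
rewrite /off_Pi (ltn_trans lt_t lt_tk).
have [//|le_k] := ltnP (sigma (ir eta)) (sigma k); first by rewrite orbT.
by rewrite !(leq_ltn_trans le_k).
Qed.

Lemma p_isotropic f : X_ s f -> isotropic f (p_ K s).
Proof.
move=> [_ f0] x y xp yp; rewrite dualE big1 // => xi _.
have [xi_s|/f0->] := boolP (xi \in s); last by rewrite mulr0.
rewrite lie_entry0 ?mul0r // => k lt_jk lt_ki.
move: xi_s; rewrite (mem_refl_decomposition dec) => /eqP exi.
have ei : sigma (ir xi) = jr xi by rewrite -exi sK.
rewrite /off_Pi ei exi lt_jk.
case: (ltngtP (jr xi) (sigma k)) => [|lt_kj|/val_inj ej]; rewrite ?orbT //.
  by rewrite (ltn_trans lt_kj (jr_lt_ir xi)).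
by move: lt_ki; rewrite -exi ej sK ltnn.
Qed.

(** The root vector to test against for a root eps_t - eps_i outside Pi is the
    one at (t, sigma(i)); it isolates a single entry of [x]. *)
Lemma p_orthogonal f x : X_ s f ->
  {in p_ K s, forall y, f (lie x y) = 0} -> x \in p_ K s.
Proof.
move=> [fN0 f0] orth; apply/mem_p => eta; rewrite (mem_Pi _ dec) negbK.
set t := jr eta; set i := ir eta; case/andP=> lt_t lt_st.
have lt_ti : (t < i)%N := jr_lt_ir eta.
pose beta : posroot n := exist _ (sigma i, t) lt_t.
pose xi0 : posroot n := exist _ (sigma i, i) (ltn_trans lt_t lt_ti).
have beta_p : y_ K beta \in p_ K s.
  apply/memv_span/image_f; rewrite (mem_Pi _ dec) /jr /ir /= sK.
  by rewrite negb_and -leqNgt ltnW.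
have xi0_s : xi0 \in s by rewrite (mem_refl_decomposition dec) /jr /ir /= sK.
have := orth _ beta_p; rewrite dualE (bigD1 xi0) //= big1 => [|xi neq].
  rewrite addr0 => /eqP; rewrite mulf_eq0 (negPf (fN0 _ xi0_s)) orbF.
  rewrite [X in X == 0]lie_y_entry /jr /ir /= eqxx mulr1.
  by rewrite (gtn_eqF lt_ti : (i == t) = false) mul0r subr0 => /eqP.
have [xi_s|/f0->] := boolP (xi \in s); last by rewrite mulr0.
move: xi_s; rewrite (mem_refl_decomposition dec) => /eqP exi.
rewrite [X in X * _]lie_y_entry.
have [ej|_] := eqVneq (jr xi) (jr beta).
  by case/eqP: neq; apply: posroot_eq => //; rewrite -exi ej sK.
rewrite mulr0 sub0r; have [et|_] := eqVneq (ir xi) (ir beta).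
  (* here xi = (sigma t, t), so the remaining entry is above the diagonal *)
  by rewrite ut_entry0 ?mulr0 ?oppr0 ?mul0r // -[jr xi]sK exi et ltnW.
by rewrite mul0r oppr0 mul0r.
Qed.

End Involution.

End Polarization.

Theorem theorem1p1 (K : fieldType) (charK : [pchar K]%R =i pred0)
    (n : nat) (sigma : 'S_n) (sigma2 : (sigma * sigma)%g = 1%g)
    (s : seq (posroot n)) (decomp : refl_decomposition sigma s)
    (f : dual_ut K n) (Xf : X_ s f) :
  polarization f (p_ K s).
Proof.
split; first exact: p_subalgebra decomp.
split; first by move=> x y; apply: (p_isotropic decomp Xf).
move=> q iso_q le_pq; apply/eqP; rewrite eqEsubv le_pq andbT.
apply/subvP => x xq; apply: (p_orthogonal decomp Xf) => y yp.
exact: iso_q xq (subvP le_pq _ yp).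
Qed.
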